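(* Let $n \geq 3$, and let $w_1>0$ and $w_i\ge 0$ for $2\le i\le n$ be real numbers with partial sums $W_i=\sum_{j=1}^i w_j$. Suppose that the following three conditions hold: $$0 < \frac{w_n\sum_{i=1}^{n-2}W_i}{W_{n-1}^2}-1 \leq \frac{w_1}{w_n},$$ $$\frac{W_{n-1}}{W_n}\prod_{i=1}^{n-2}\left(\frac{W_{i+1}}{W_i}\right)^{\frac{W_iw_n}{W_{n-1}^2}} \leq 1,$$ $$\left(\frac{W_{n-1}w_n}{W_nw_1}\left(\sum_{i=1}^{n-2}\frac{W_iw_n}{W_{n-1}^2}-1\right)+\frac{w_n}{W_n}\right)\prod_{i=1}^{n-2}\left(\frac{W_{i+1}}{w_{i+1}}\right)^{\frac{w_{i+1}}{W_{n-1}}} \leq 1.$$ Then for all real numbers $x_1,\dots,x_n>0$, $$W_{n-1}\Big(M_{n-1,0}({\bf M}_{n-1,1})-M_{n-1,1}({\bf M}_{n-1,0})\Big) \leq W_n\Big(M_{n,0}({\bf M}_{n,1})-M_{n,1}({\bf M}_{n,0})\Big).$$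
   Context: Given ${\bf x}=(x_1,\dots,x_n)$ with all $x_i>0$ and weights ${\bf w}=(w_1,\dots,w_n)$ with $w_1>0$, $w_i\ge 0$, put $W_i=\sum_{j=1}^i w_j$. For $1\le i\le n$ define the weighted arithmetic and geometric means of the first $i$ entries: $$M_{i,1}=\frac{1}{W_i}\sum_{j=1}^i w_jx_j,\qquad M_{i,0}=\prod_{j=1}^i x_j^{w_j/W_i},$$ and the vectors ${\bf M}_{i,1}=(M_{1,1},\dots,M_{i,1})$ and ${\bf M}_{i,0}=(M_{1,0},\dots,M_{i,0})$. The mixed means are formed with the same weights: for $m\in\{n-1,n\}$, $$M_{m,0}({\bf M}_{m,1})=\prod_{i=1}^m \left(M_{i,1}\right)^{w_i/W_m},\qquad M_{m,1}({\bf M}_{m,0})=\frac{1}{W_m}\sum_{i=1}^m w_i M_{i,0}.$$ Convention: if $w_{i+1}=0$, the factor $(W_{i+1}/w_{i+1})^{w_{i+1}/W_{n-1}}$ is interpreted as its limiting value $1$. (The first condition forces $w_n>0$.) *)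

(* Defs.v *)
From HB Require Import structures.
From mathcomp Require Import all_boot all_order all_algebra.
From mathcomp Require Import all_classical all_reals all_analysis.

Set Implicit Arguments.
Unset Strict Implicit.
Unset Printing Implicit Defensive.

Import Order.TTheory GRing.Theory Num.Theory.
Local Open Scope ring_scope.

(* Vectors (v_1, ..., v_n) are represented by functions v : nat -> R, of which
   only the values v 1, ..., v n are relevant; indices start at 1. This makes
   the vector of means (M_1, ..., M_m) of the initial segments of x simply the
   function i |-> M_i, so that the means can be composed. *)

Definition psum (R : realType) (w : nat -> R) (i : nat) : R :=
  \sum_(1 <= j < i.+1) w j.

Definition amean (R : realType) (w x : nat -> R) (i : nat) : R :=
  (psum w i)^-1 * \sum_(1 <= j < i.+1) w j * x j.

Definition gmean (R : realType) (w x : nat -> R) (i : nat) : R :=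
  \prod_(1 <= j < i.+1) x j `^ (w j / psum w i).

(* M_{m,0}(M_{m,1}) *)
Definition gmean_of_ameans (R : realType) (w x : nat -> R) (m : nat) : R :=
  gmean w (amean w x) m.

(* M_{m,1}(M_{m,0}) *)
Definition amean_of_gmeans (R : realType) (w x : nat -> R) (m : nat) : R :=
  amean w (gmean w x) m.

(* Main.v *)
Require Import Defs.
From HB Require Import structures.
From mathcomp Require Import all_boot all_order all_algebra.
From mathcomp Require Import all_classical all_reals all_analysis.
From mathcomp Require Import ring lra.

Set Implicit Arguments.
Unset Strict Implicit.
Unset Printing Implicit Defensive.

Import Order.TTheory GRing.Theory Num.Theory.
Import numFieldNormedType.Exports.
Local Open Scope ring_scope.

(** Write A_i and G_i for the arithmetic and geometric means of the first i
entries. Multiplied by W_n and W_(n-1), the outer arithmetic means of the G_i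
differ by w_n G_n, so the claim is
  w_n G_n + W_(n-1) P <= W_n Q,
where P and Q are the geometric means of A_1, ..., A_(n-1) and A_1, ..., A_n.
In the ratios u_(i+1) = x_(i+1) / A_(i+1) and y_i = A_i / A_(i+1), which are
linked by w_(i+1) u_(i+1) + W_i y_i = W_(i+1), put
  P1 = \prod_(i <= n-2) u_(i+1) ^ (w_(i+1) / W_(n-1)),
  P2 = \prod_(i <= n-2) y_i ^ (W_i w_n / W_(n-1)^2).
Then G_n / Q and P / Q are the weighted geometric means, with weights W_(n-1)
and w_n, of P1 and u_n, and of P2 and y_(n-1) (the latter by Abel summation).
Bounding each by its arithmetic mean ([le_weighted_amgm]) and using the link
between u_n and y_(n-1) reduces the claim to
  w_n P1 + W_(n-1) P2 <= W_n,
which is [two_products_le].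

Let t = P2 / P1, so that the left side is P1 (w_n + W_(n-1) t). Write 1 + d for
the sum of the exponents in P2; the first condition says 0 < d <= w_1 / w_n.
Let t0 = w_n d / w_1, so that 0 < t0 <= 1.

If t <= t0, then u_(i+1) <= W_(i+1) / w_(i+1) bounds P1, and the third
condition is exactly the resulting estimate at t = t0.

If t >= t0, we maximize w_(i+1) ln u_(i+1) + W_i t ln y_i for each i on the
segment given by the link; the maximum is at y_i = t u_(i+1)
([tangent_ln_le]). Summing bounds (w_n + W_(n-1) t) ln P1 by an explicit
function of t, and what remains is that a certain combination of functions
[linlog] is nonpositive. That combination vanishes to second order at t = 1,
and on t >= t0 it is concave ([linlog_combination_le0]), because its second
derivative reduces to a sum of fractions that [sum_fractions_le] controls
when w_n d <= w_1 t. *)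

(** * A one-variable inequality *)

Lemma ler_at_critical (R : realType) (f df ddf : R -> R) (a c : R) :
    a <= c ->
    (forall x, a <= x -> is_derive x 1 f (df x)) ->
    (forall x, a <= x -> is_derive x 1 df (ddf x)) ->
    (forall x, a <= x -> ddf x <= 0) ->
    df c = 0 ->
  forall x, a <= x -> f x <= f c.
Proof.
move=> ac fD dfD ddf_le0 dfc0.
have MVTa (h dh : R -> R) : (forall x, a <= x -> is_derive x 1 h (dh x)) ->
    forall x y, a <= x -> x < y ->
    exists2 z, x < z < y & h y - h x = dh z * (y - x).
  move=> hD x y ax xy; have [||z] := @MVT R h dh x y xy.
  - by move=> z; rewrite in_itv/= => /andP[xz _]; apply/hD/(le_trans ax)/ltW.
  - apply: derivable_within_continuous => z; rewrite in_itv/= => /andP[xz _].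
    by apply: ex_derive; apply/hD/(le_trans ax).
  - by rewrite in_itv/= => zxy ?; exists z.
move=> x ax; have [xc|cx|->//] := ltgtP x c.
  have [z /andP[xz zc] fE] := MVTa _ _ fD _ _ ax xc.
  have az : a <= z by rewrite (le_trans ax)// ltW.
  have [y /andP[zy yc] dfE] := MVTa _ _ dfD _ _ az zc.
  have ddfy := ddf_le0 y (le_trans az (ltW zy)).
  have dfz : 0 <= df z.
    have : df c - df z <= 0 by rewrite dfE mulr_le0_ge0// subr_ge0 ltW.
    by rewrite dfc0 sub0r oppr_le0.
  by rewrite -subr_ge0 fE mulr_ge0// subr_ge0 ltW.
have [z /andP[cz zx] fE] := MVTa _ _ fD _ _ ac cx.
have [y /andP[cy yz] dfE] := MVTa _ _ dfD _ _ ac cz.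
have ddfy := ddf_le0 y (le_trans ac (ltW cy)).
have dfz : df z <= 0.
  have : df z - df c <= 0 by rewrite dfE mulr_le0_ge0// subr_ge0 ltW.
  by rewrite dfc0 subr0.
by rewrite -subr_le0 fE mulr_le0_ge0// subr_ge0 ltW.
Qed.

(** The function s ln s evaluated along the line from 1 with slope b / (a + b),
times a + b, minus its tangent line at t = 1. Subtracting the tangent makes
value and derivative at 1 vanish in every linear combination. *)
Definition linlog (R : realType) (a b t : R) : R :=
  (a + b * t) * ln ((a + b * t) / (a + b)) - b * (t - 1).

Lemma linlog1 (R : realType) (a b : R) : 0 < a + b -> linlog a b 1 = 0.
Proof.
by move=> ab; rewrite /linlog mulr1 divff ?gt_eqF// ln1 subrr !mulr0 subrr.
Qed.

Lemma is_derive_affine (R : realType) (a b t : R) :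
  is_derive t 1 (fun t => a + b * t) b.
Proof.
have := is_deriveD (is_derive_cst a t 1) (is_deriveZ b (is_derive_id t 1)).
by rewrite add0r [_ *: 1]mulr1.
Qed.

Lemma is_derive_ln_affine (R : realType) (a b t : R) :
    0 <= a -> 0 < b -> 0 < t ->
  is_derive t 1 (fun t => ln ((a + b * t) / (a + b))) (b / (a + b * t)).
Proof.
move=> a0 b0 t0; have ab : 0 < a + b by lra.
have abt : 0 < a + b * t by rewrite ltr_wpDl// mulr_gt0.
have affE x : (a + b * x) / (a + b) = a / (a + b) + b / (a + b) * x.
  by rewrite -mulrAC -mulrDl.
have abt' : 0 < a / (a + b) + b / (a + b) * t by rewrite -affE divr_gt0.
under [X in is_derive _ _ X]eq_fun do rewrite affE.
have := @is_derive1_comp R (@ln R) (fun t => a / (a + b) + b / (a + b) * t)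
  _ _ _ (is_derive1_ln abt') (is_derive_affine (a / (a + b)) (b / (a + b)) t).
rewrite -affE invf_div; set d := (X in is_derive _ _ _ X -> _).
suff -> : d = b / (a + b * t) by [].
by rewrite /d; field; rewrite !gt_eqF.
Qed.

Lemma is_derive_linlog (R : realType) (a b t : R) :
    0 <= a -> 0 < b -> 0 < t ->
  is_derive t 1 (linlog a b) (b * ln ((a + b * t) / (a + b))).
Proof.
move=> a0 b0 t0; have abt : 0 < a + b * t by rewrite ltr_wpDl// mulr_gt0.
have -> : linlog a b = (fun t => a + b * t) *
    (fun t => ln ((a + b * t) / (a + b))) - (fun t => - b + b * t).
  by apply/funext => x; rewrite /linlog mulrBr mulr1 (addrC _ (- b)).
have D1 := is_derive_affine a b t; have D2 := is_derive_affine (- b) b t.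
have D3 := is_derive_ln_affine a0 b0 t0.
apply: (is_derive_eq (is_deriveB (is_deriveM D1 D3) D2)).
by rewrite /GRing.scale/=; field; rewrite gt_eqF.
Qed.

(** The bound replaces a / (a + b t) by r / (r + t) in the identity
  (r + t) a b / (a + b t) = a + (r b - a) a / (a + b t).
The first fraction is at most the second exactly when r b - a >= 0, so the
replacement goes up for both signs of r b - a: the error is a square. *)
Lemma sum_fractions_le (R : realType) (k : nat) (a b : 'I_k -> R) (r t : R) :
    (forall i, 0 <= a i) -> (forall i, 0 < b i) -> 0 < r -> 0 < t ->
  \sum_i a i * b i / (a i + b i * t) <=
    (\sum_i a i + r / (r + t) * (r * \sum_i b i - \sum_i a i)) / (r + t).
Proof.
move=> a0 b0 r0 t0; have rt : 0 < r + t by rewrite addr_gt0.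
rewrite mulr_sumr -sumrB mulr_sumr -big_split/= mulr_suml ler_sum// => i _.
have abt : 0 < a i + b i * t by rewrite ltr_wpDl// mulr_gt0.
rewrite -subr_ge0.
have -> : (a i + r / (r + t) * (r * b i - a i)) / (r + t) -
    a i * b i / (a i + b i * t) =
  t * (r * b i - a i) ^+ 2 / ((a i + b i * t) * (r + t) ^+ 2).
  by field; rewrite !gt_eqF.
by rewrite divr_ge0// mulr_ge0 ?sqr_ge0// ltW.
Qed.

(** Let t0 = wn (S - 1) / w1. For t >= t0 the second derivative of the left side
is nonpositive, and value and derivative vanish at 1 >= t0. The coefficient
S - 1 makes
the terms in 1 / t of the second derivative cancel up to
  (wn / (t V)) (\sum_i a i b i / (a i + b i t) - V / (wn / V + t)). *)
Lemma linlog_combination_le0 (R : realType) (k : nat) (a b : 'I_k -> R)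
    (w1 wn t : R) (V := w1 + \sum_i a i) (S := wn * (\sum_i b i) / V ^+ 2) :
    (forall i, 0 <= a i) -> (forall i, 0 < b i) -> 0 < w1 -> 0 < wn ->
    0 < S - 1 <= w1 / wn -> wn * (S - 1) / w1 <= t ->
  linlog wn V t - wn / V * (\sum_i linlog (a i) (b i) t) +
    (S - 1) * V * linlog 0 1 t <= 0.
Proof.
move=> a0 b0 w10 wn0 /andP[S1 Sw] ht.
have V0 : 0 < V by rewrite ltr_wpDr// sumr_ge0.
have SE : wn * (\sum_i b i) = S * V ^+ 2 by rewrite /S; field; rewrite gt_eqF.
set t0 := wn * (S - 1) / w1 in ht.
have t00 : 0 < t0 by rewrite divr_gt0 ?mulr_gt0.
have t01 : t0 <= 1 by rewrite ler_pdivrMr// mul1r mulrC -ler_pdivlMr.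
pose f := linlog wn V - (wn / V) *: (\sum_i linlog (a i) (b i)) +
  ((S - 1) * V) *: linlog 0 1.
pose df := (fun t => V * ln ((wn + V * t) / (wn + V))) -
  (wn / V) *: (\sum_i fun t => b i * ln ((a i + b i * t) / (a i + b i))) +
  ((S - 1) * V) *: (fun t => 1 * ln ((0 + 1 * t) / (0 + 1))).
pose ddf x := V * (V / (wn + V * x)) -
  (wn / V) * (\sum_i b i * (b i / (a i + b i * x))) +
  ((S - 1) * V) * (1 * (1 / (0 + 1 * x))).
have fE x : f x = linlog wn V x - wn / V * (\sum_i linlog (a i) (b i) x) +
    (S - 1) * V * linlog 0 1 x.
  by rewrite /f !fctE/= fct_sumE.
have f1 : f 1 = 0.
  rewrite fE (linlog1 (addr_gt0 wn0 V0)) (@linlog1 _ 0 1) ?add0r//.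
  by rewrite big1 ?mulr0 ?oppr0 ?addr0// => i _; rewrite linlog1// ltr_wpDl.
have fD x : t0 <= x -> is_derive x 1 f (df x).
  move=> xt0; have x0 := lt_le_trans t00 xt0.
  have D1 := is_derive_linlog (ltW wn0) V0 x0.
  have D2 := is_derive_sum (fun i => is_derive_linlog (a0 i) (b0 i) x0).
  have D3 := is_derive_linlog (lexx 0) ltr01 x0.
  have D := is_deriveD (is_deriveB D1 (is_deriveZ (wn / V) D2))
    (is_deriveZ ((S - 1) * V) D3).
  apply: (is_derive_eq D).
  by rewrite /df !fctE/= fct_sumE.
have dfD x : t0 <= x -> is_derive x 1 df (ddf x).
  move=> xt0; have x0 := lt_le_trans t00 xt0.
  have D1 := is_deriveZ V (is_derive_ln_affine (ltW wn0) V0 x0).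
  have D2 := is_derive_sum
    (fun i => is_deriveZ (b i) (is_derive_ln_affine (a0 i) (b0 i) x0)).
  have D3 := is_deriveZ 1 (is_derive_ln_affine (lexx 0) ltr01 x0).
  exact: (is_deriveD (is_deriveB D1 (is_deriveZ (wn / V) D2))
    (is_deriveZ ((S - 1) * V) D3)).
have ddf_le0 x : t0 <= x -> ddf x <= 0.
  move=> xt0; have x0 := lt_le_trans t00 xt0.
  set T := \sum_i a i * b i / (a i + b i * x).
  have rx : 0 < wn / V + x by rewrite addr_gt0 ?divr_gt0.
  have D0 : 0 < wn + V * x by rewrite addr_gt0 ?mulr_gt0.
  have ddfE : ddf x = wn / x / V * (T - V / (wn / V + x)).
    have sumE : \sum_i b i * (b i / (a i + b i * x)) = (\sum_i b i - T) / x.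
      rewrite -sumrB mulr_suml; apply: eq_bigr => i _.
      by field; rewrite !gt_eqF// ltr_wpDl// mulr_gt0.
    have -> : ddf x = V * V / (wn + V * x) -
        (wn * (\sum_i b i) / V - wn / V * T) / x + (S - 1) * V / x.
      by rewrite /ddf sumE; field; rewrite !gt_eqF.
    by rewrite SE; field; rewrite (mulrC x) !gt_eqF.
  rewrite ddfE mulr_ge0_le0 ?divr_ge0 ?(ltW x0) ?(ltW wn0) ?(ltW V0)//.
  rewrite subr_le0.
  apply: le_trans (sum_fractions_le a0 b0 (divr_gt0 wn0 V0) x0) _.
  have -> : wn / V * (\sum_i b i) = S * V.
    by rewrite mulrAC SE; field; rewrite gt_eqF.
  have -> : \sum_i a i = V - w1 by rewrite /V addrC addKr.
  rewrite ler_pM2r ?invr_gt0//.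
  suff : wn / V / (wn / V + x) * (S * V - (V - w1)) <= w1 by lra.
  rewrite mulrAC ler_pdivrMr//.
  have -> : wn / V * (S * V - (V - w1)) = wn * (S - 1) + w1 * (wn / V).
    by field; rewrite gt_eqF.
  by rewrite (mulrDr w1) addrC lerD2l (mulrC w1 x) -ler_pdivrMr.
have df1 : df 1 = 0.
  rewrite /df !fctE/= fct_sumE !mulr1 !divff ?ln1 ?mulr0 ?addr0 ?gt_eqF//.
    rewrite big1 ?scaler0 ?subrr ?addr0// => i _.
    by rewrite mulr1 divff ?ln1 ?mulr0 ?gt_eqF ?ltr_wpDl.
  by rewrite addr_gt0.
rewrite -fE; suff: f t <= f 1 by rewrite f1.
exact: (ler_at_critical t01 fD dfD ddf_le0 df1 ht).
Qed.

(** * The inequality between the two products *)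

Lemma ln_le_subr1 (R : realType) (x : R) : 0 < x -> ln x <= x - 1.
Proof.
by move=> x0; rewrite -[x in ln x](subrKC 1) le_ln1Dx// ltrBrDl subrr.
Qed.

Lemma ln_prod_powR (R : realType) (I : Type) (r : seq I) (P : pred I)
    (z e : I -> R) : (forall i, P i -> 0 < z i) ->
  ln (\prod_(i <- r | P i) z i `^ e i) = \sum_(i <- r | P i) e i * ln (z i).
Proof.
move=> z0; suff -> : \prod_(i <- r | P i) z i `^ e i =
  expR (\sum_(i <- r | P i) e i * ln (z i)) by rewrite expRK.
rewrite expR_sum; apply: eq_bigr => i Pi.
by rewrite -ln_powR lnK// posrE powR_gt0// z0.
Qed.

(** On the segment a u + b y = a + b the concave function on the left has its
maximum at u = (a + b) / (a + b t), y = t u; the right side is that maximum.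
The proof adds the tangent inequalities of ln at this point, whose linear parts
cancel on the segment. *)
Lemma tangent_ln_le (R : realType) (a b u y t : R) :
    0 <= a -> 0 < b -> 0 < u -> 0 < y -> 0 < t -> a * u + b * y = a + b ->
  a * ln u + b * t * ln y <=
    - (linlog a b t + b * (t - 1)) + b * t * ln t.
Proof.
move=> a0 b0 u0 y0 t0 uyE.
have ab : 0 < a + b by rewrite ltr_wpDl.
have abt : 0 < a + b * t by rewrite ltr_wpDl// mulr_gt0.
rewrite /linlog subrK; set q := (a + b * t) / (a + b).
have q0 : 0 < q by rewrite divr_gt0.
have lnu : ln u <= u * q - 1 - ln q.
  by rewrite lerBrDr -lnM ?posrE// ln_le_subr1// mulr_gt0.
have lny : ln y <= y * q / t - 1 - ln q + ln t.
  have := ln_le_subr1 (divr_gt0 (mulr_gt0 y0 q0) t0).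
  rewrite (_ : ln (y * q / t) = ln y + ln q - ln t); first lra.
  have yq0 := mulr_gt0 y0 q0.
  by rewrite (@ln_div _ (y * q) t)// (@lnM _ y q).
have := ler_wpM2l a0 lnu; have := ler_wpM2l (ltW (mulr_gt0 b0 t0)) lny.
have -> : b * t * (y * q / t - 1 - ln q + ln t) =
    b * y * q - b * t - b * t * ln q + b * t * ln t.
  by field; rewrite gt_eqF.
have : a * u * q + b * y * q = a + b * t.
  by rewrite -mulrDl uyE mulrC divfK// gt_eqF.
lra.
Qed.

(** The ratio t of the two products decides which argument applies: the bound
Pmax on the first product when t is small, the maximization at slope t when t is
large. This slope is the one to take: where the left side is critical under the
constraints, y_i = t u_i for all i with t this very ratio. *)
Lemma two_products_le (R : realType) (k : nat) (a b u y : 'I_k -> R)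
    (w1 wn : R) (V := w1 + \sum_i a i) (S := wn * (\sum_i b i) / V ^+ 2) :
    (forall i, 0 <= a i) -> (forall i, 0 < b i) ->
    (forall i, 0 < u i) -> (forall i, 0 < y i) ->
    (forall i, a i * u i + b i * y i = a i + b i) ->
    0 < w1 -> 0 < wn -> 0 < S - 1 <= w1 / wn ->
    ((V * wn) / ((wn + V) * w1) * (S - 1) + wn / (wn + V)) *
      \prod_i ((a i + b i) / a i) `^ (a i / V) <= 1 ->
  wn * \prod_i u i `^ (a i / V) + V * \prod_i y i `^ (b i * wn / V ^+ 2)
    <= wn + V.
Proof.
move=> a0 b0 u0 y0 uyE w10 wn0 S1 Pmax_le.
have V0 : 0 < V by rewrite ltr_wpDr// sumr_ge0.
set P1 := \prod_i u i `^ _; set P2 := \prod_i y i `^ _.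
have P10 : 0 < P1 by apply: prodr_gt0 => i _; exact: powR_gt0.
have P20 : 0 < P2 by apply: prodr_gt0 => i _; exact: powR_gt0.
set Pmax := \prod_i _ in Pmax_le.
have P1max : P1 <= Pmax.
  apply: ler_prod => i _; rewrite powR_ge0/=.
  have [->|ai0] := eqVneq (a i) 0; first by rewrite mul0r !powRr0.
  have {}ai0 : 0 < a i by rewrite lt_neqAle eq_sym ai0 a0.
  have u_le : u i <= (a i + b i) / a i.
    by rewrite ler_pdivlMr// mulrC -uyE lerDl ltW// mulr_gt0.
  apply: ge0_ler_powR; rewrite // ?nnegrE ?(le_trans _ u_le) ?ltW//.
  by rewrite divr_gt0.
set t := P2 / P1.
have t0 : 0 < t by rewrite divr_gt0.
have P2E : P2 = t * P1 by rewrite divfK// gt_eqF.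
have D0 : 0 < wn + V * t by rewrite addr_gt0// mulr_gt0.
have WV : 0 < wn + V by rewrite addr_gt0.
have -> : wn * P1 + V * P2 = P1 * (wn + V * t) by rewrite P2E; ring.
(* The hypothesis on Pmax says Pmax (wn + V t) <= wn + V at this threshold. *)
have [t_small|t_large] := leP t (wn * (S - 1) / w1).
  apply: (@le_trans _ _ (Pmax * (wn + V * (wn * (S - 1) / w1)))).
    by rewrite ler_pM ?(ltW P10) ?(ltW D0)// lerD2l ler_wpM2l// ltW.
  rewrite -[leRHS]mulr1 -ler_pdivrMl//; apply: le_trans Pmax_le.
  by rewrite le_eqVlt; apply/orP; left; apply/eqP; field; rewrite !gt_eqF.
have bS : wn / V * (\sum_i b i) = S * V by rewrite /S; field; rewrite gt_eqF.
have lnP2 : ln P2 = ln t + ln P1 by rewrite P2E lnM.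
have lnPs : wn * ln P1 + V * t * ln P2 =
    wn / V * (\sum_i (a i * ln (u i) + b i * t * ln (y i))).
  rewrite !ln_prod_powR// big_split/= mulrDr !mulr_sumr.
  by congr (_ + _); apply: eq_bigr => i _; field; rewrite gt_eqF.
have lnPs_le : wn * ln P1 + V * t * ln P2 <=
    - (wn / V * (\sum_i linlog (a i) (b i) t)) +
    S * V * (t * ln t - (t - 1)).
  rewrite lnPs -bS.
  have -> : - (wn / V * (\sum_i linlog (a i) (b i) t)) +
      wn / V * (\sum_i b i) * (t * ln t - (t - 1)) =
      wn / V * \sum_i (- (linlog (a i) (b i) t + b i * (t - 1)) +
                       b i * t * ln t).
    move: (wn / V) => c.
    rewrite -mulrA -mulrN -mulrDr mulr_suml -sumrN -big_split/=.
    by congr (_ * _); apply: eq_bigr => i _; ring.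
  rewrite ler_wpM2l ?divr_ge0 ?(ltW wn0) ?(ltW V0)// ler_sum// => i _.
  exact: tangent_ln_le.
have := linlog_combination_le0 a0 b0 w10 wn0 S1 (ltW t_large).
rewrite -/V -/S [linlog wn V t]/linlog.
have -> : linlog 0 1 t = t * ln t - (t - 1).
  by rewrite /linlog !add0r !mul1r divr1.
move=> lin.
have lnF : (wn + V * t) * ln (P1 * ((wn + V * t) / (wn + V))) <= 0.
  rewrite lnM ?posrE ?divr_gt0//; move: lnPs_le lin; rewrite lnP2.
  lra.
rewrite -[leRHS]mul1r -ler_pdivrMr// -mulrA.
rewrite -ler_ln ?posrE ?mulr_gt0 ?invr_gt0//.
by rewrite ln1 -(pmulr_rle0 _ D0).
Qed.

(** * Means of initial segments *)

Lemma le_weighted_amgm (R : realType) (a b p q g : R) :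
    0 <= a -> 0 <= b -> 0 < p -> 0 < q -> 0 < g ->
    (a + b) * ln g = a * ln p + b * ln q ->
  (a + b) * g <= a * p + b * q.
Proof.
move=> a0 b0 p0 q0 g0 lngE.
have := ler_wpM2l a0 (ln_le_subr1 (divr_gt0 p0 g0)).
have := ler_wpM2l b0 (ln_le_subr1 (divr_gt0 q0 g0)).
rewrite !ln_div// => hq hp; rewrite -ler_pdivlMr//.
have -> : (a * p + b * q) / g = a * (p / g) + b * (q / g) by ring.
lra.
Qed.

Lemma sum_from1 (R : realType) (F : nat -> R) (k : nat) :
  \sum_(1 <= i < k.+1) F i = \sum_(i < k) F i.+1.
Proof. by rewrite big_add1 big_mkord. Qed.

Lemma sum_from1_split (R : realType) (F : nat -> R) (k : nat) :
  \sum_(1 <= i < k.+2) F i = F 1%N + \sum_(i < k) F i.+2.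
Proof. by rewrite sum_from1 big_ord_recl. Qed.

Lemma psumS (R : realType) (w : nat -> R) (i : nat) :
  psum w i.+1 = psum w i + w i.+1.
Proof. by rewrite /psum big_nat_recr. Qed.

Lemma ameanM (R : realType) (w x : nat -> R) (i : nat) : 0 < psum w i ->
  psum w i * amean w x i = \sum_(1 <= j < i.+1) w j * x j.
Proof. by move=> W0; rewrite /amean mulVKf ?gt_eqF. Qed.

Lemma gmean_gt0 (R : realType) (w x : nat -> R) (i : nat) :
  (forall j, (1 <= j <= i)%N -> 0 < x j) -> 0 < gmean w x i.
Proof.
move=> x0; rewrite /gmean big_nat.
by apply: prodr_gt0 => j /x0; exact: powR_gt0.
Qed.

Lemma ln_gmean (R : realType) (w x : nat -> R) (i : nat) : 0 < psum w i ->
    (forall j, (1 <= j <= i)%N -> 0 < x j) ->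
  psum w i * ln (gmean w x i) = \sum_(1 <= j < i.+1) w j * ln (x j).
Proof.
move=> W0 x0; rewrite /gmean big_nat ln_prod_powR// -big_nat mulr_sumr.
by apply: eq_bigr => j _; field; rewrite gt_eqF.
Qed.

(** Abel summation; it turns the product of powers of ratios of consecutive
    means into a geometric mean of those means. *)
Lemma abel_psum (R : realType) (w f : nat -> R) (k : nat) :
  \sum_(i < k) psum w i.+1 * (f i.+1 - f i.+2) =
  \sum_(1 <= j < k.+2) w j * f j - psum w k.+1 * f k.+1.
Proof.
elim: k => [|k IHk]; first by rewrite big_ord0 /psum !big_nat1 subrr.
by rewrite big_ord_recr/= IHk [in RHS]big_nat_recr//= (psumS w k.+1); ring.
Qed.

Lemma psum_gt0 (R : realType) (w : nat -> R) (n i : nat) :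
    0 < w 1%N -> (forall i, (2 <= i <= n)%N -> 0 <= w i) ->
  (1 <= i <= n)%N -> 0 < psum w i.
Proof.
move=> w1 w_ge0.
case: i => // -[_|i /andP[_ iN]]; first by rewrite /psum big_nat1.
rewrite /psum sum_from1_split ltr_wpDr// sumr_ge0// => j _.
by rewrite w_ge0//= (leq_trans _ iN)// ltnS ltn_ord.
Qed.

Lemma amean_gt0 (R : realType) (w x : nat -> R) (n i : nat) :
    0 < w 1%N -> (forall i, (2 <= i <= n)%N -> 0 <= w i) ->
    (forall i, (1 <= i <= n)%N -> 0 < x i) ->
  (1 <= i <= n)%N -> 0 < amean w x i.
Proof.
move=> w1 w_ge0 x0.
case: i => // i iN; rewrite /amean mulr_gt0 ?invr_gt0 ?(psum_gt0 w1 w_ge0)//.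
have {}iN : (i < n)%N by [].
have x1 : 0 < x 1%N by rewrite x0// (leq_ltn_trans _ iN).
rewrite sum_from1; case: i iN => [|i] iN; first by rewrite big_ord1 mulr_gt0.
rewrite big_ord_recl ltr_wpDr ?mulr_gt0// sumr_ge0// => j _.
have jN : (j.+2 <= n)%N by rewrite (leq_trans _ iN)// ltnS ltn_ord.
by rewrite mulr_ge0 ?w_ge0// ltW// x0.
Qed.

Lemma amean1 (R : realType) (w x : nat -> R) : 0 < w 1%N ->
  amean w x 1 = x 1%N.
Proof. by move=> w1; rewrite /amean /psum !big_nat1 mulKf// gt_eqF. Qed.

Lemma ameanS (R : realType) (w x : nat -> R) (i : nat) :
    0 < psum w i -> 0 < psum w i.+1 ->
  psum w i.+1 * amean w x i.+1 = psum w i * amean w x i + w i.+1 * x i.+1.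
Proof. by move=> Wi WSi; rewrite !ameanM// big_nat_recr. Qed.

(** * The inequality for mixed means *)

(* If w i.+1 = 0 then the factor (W i.+1 / w i.+1) `^ (w i.+1 / W n.-1) is 1,
   since a `^ 0 = 1 for every a (powRr0). *)
Theorem theorem1p5 (R : realType) (n : nat) (w : nat -> R)
    (W := psum w)
    (hn : (3 <= n)%N)
    (hw1 : 0 < w 1%N)
    (hw : forall i : nat, (2 <= i <= n)%N -> 0 <= w i)
    (cond1 : 0 < w n * (\sum_(1 <= i < n.-1) W i) / W n.-1 ^+ 2 - 1
               <= w 1%N / w n)
    (cond2 : W n.-1 / W n *
             \prod_(1 <= i < n.-1)
               (W i.+1 / W i) `^ (W i * w n / W n.-1 ^+ 2) <= 1)
    (cond3 : ((W n.-1 * w n) / (W n * w 1%N) *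
                (\sum_(1 <= i < n.-1) (W i * w n / W n.-1 ^+ 2) - 1)
              + w n / W n) *
             \prod_(1 <= i < n.-1)
               (W i.+1 / w i.+1) `^ (w i.+1 / W n.-1) <= 1) :
  forall x : nat -> R, (forall i : nat, (1 <= i <= n)%N -> 0 < x i) ->
    W n.-1 * (gmean_of_ameans w x n.-1 - amean_of_gmeans w x n.-1) <=
    W n * (gmean_of_ameans w x n - amean_of_gmeans w x n).
Proof.
move=> x x0.
case: n => [|[|k]]// in hn hw cond1 cond2 cond3 x0 *.
have {hn} k0 : (0 < k)%N by [].
move: cond1 cond3 => {cond2}; rewrite [k.+2.-1]/= !sum_from1.
rewrite [X in _ * X <= 1 -> _](_ : _ = \prod_(i < k)
  ((w i.+2 + W i.+1) / w i.+2) `^ (w i.+2 / W k.+1)); last first.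
  rewrite big_add1 big_mkord; apply: eq_bigr => i _.
  by rewrite /W psumS (addrC (w _)).
rewrite -!mulr_suml (mulrC (\sum_(i < k) _) (w k.+2)) => cond1 cond3.
have W0 i : (1 <= i <= k.+2)%N -> 0 < W i by exact: psum_gt0.
pose A := amean w x; have A0 i : (1 <= i <= k.+2)%N -> 0 < A i.
  exact: amean_gt0.
have V0 : 0 < W k.+1 by apply: W0; rewrite leqnSn.
have Wn0 : 0 < W k.+2 by apply: W0; rewrite leqnn.
have wn0 : 0 < w k.+2.
  rewrite lt_neqAle hw ?ltnS ?k0 ?leqnn// andbT eq_sym; apply/eqP => wn0.
  by move: cond1; rewrite wn0 !mul0r sub0r ltr0N1.
have VE : W k.+1 = w 1%N + \sum_(i < k) w i.+2 by exact: sum_from1_split.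
have WnE : W k.+2 = w k.+2 + W k.+1 by rewrite /W psumS addrC.
have step i : (1 <= i)%N -> (i.+1 <= k.+2)%N ->
    w i.+1 * (x i.+1 / A i.+1) + W i * (A i / A i.+1) = w i.+1 + W i.
  move=> i1 iN; have iN' : (1 <= i <= k.+2)%N by rewrite i1 ltnW.
  rewrite (addrC (w _)) -[W i + _]psumS.
  rewrite (mulrA _ (x _)) (mulrA _ (A _)) -mulrDl (addrC (w _ * _)).
  rewrite -(ameanS x (W0 i iN') (W0 i.+1 iN)) mulfK// gt_eqF//.
  exact: A0.
pose u i := x i / A i; pose y i := A i / A i.+1.
have u0 i : (1 <= i <= k.+2)%N -> 0 < u i.
  by move=> iN; rewrite divr_gt0 ?x0 ?A0.
have y0 i : (1 <= i)%N -> (i.+1 <= k.+2)%N -> 0 < y i.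
  by move=> i1 iN; rewrite divr_gt0 ?A0 ?i1// ltnW.
have lnu i : (1 <= i <= k.+2)%N -> ln (u i) = ln (x i) - ln (A i).
  by move=> iN; apply: ln_div; rewrite posrE ?x0 ?A0.
have lny i : (1 <= i)%N -> (i.+1 <= k.+2)%N ->
    ln (y i) = ln (A i) - ln (A i.+1).
  by move=> i1 iN; apply: ln_div; rewrite posrE A0// i1 ltnW.
have ik (i : 'I_k) : (i.+2 <= k.+2)%N by rewrite ltnW// !ltnS.
pose P1 := \prod_(i < k) u i.+2 `^ (w i.+2 / W k.+1).
pose P2 := \prod_(i < k) y i.+1 `^ (W i.+1 * w k.+2 / W k.+1 ^+ 2).
have main : w k.+2 * P1 + W k.+1 * P2 <= W k.+2.
  have := @two_products_le R k (fun i => w i.+2) (fun i => W i.+1)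
    (fun i => u i.+2) (fun i => y i.+1) (w 1%N) (w k.+2).
  cbv zeta; rewrite -VE -WnE; apply => // i.
  - by apply: hw => /=.
  - by apply: W0 => /=; rewrite ltnW.
  - exact: (u0 i.+2 (ik i)).
  - exact: (y0 i.+1 isT (ik i)).
  - exact: (step i.+1 isT (ik i)).
have P10 : 0 < P1.
  by apply: prodr_gt0 => i _; exact: (powR_gt0 _ (u0 i.+2 (ik i))).
have P20 : 0 < P2.
  by apply: prodr_gt0 => i _; exact: (powR_gt0 _ (y0 i.+1 isT (ik i))).
(* The first terms of the two sums cancel since A_1 = x_1. *)
have lnP1 : W k.+1 * ln P1 =
    \sum_(1 <= j < k.+2) w j * ln (x j) - \sum_(1 <= j < k.+2) w j * ln (A j).
  rewrite !sum_from1_split [A 1%N](amean1 x hw1) opprD addrACA subrr add0r.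
  rewrite ln_prod_powR => [|i _]; last exact: (u0 i.+2 (ik i)).
  rewrite -sumrB mulr_sumr; apply: eq_bigr => i _.
  rewrite (lnu i.+2 (ik i)).
  by field; rewrite gt_eqF.
set G := gmean w x k.+2; set P := gmean w A k.+1; set Q := gmean w A k.+2.
have xV j : (1 <= j <= k.+1)%N -> 0 < x j.
  by case/andP => j1 jk; rewrite x0// j1 leqW.
have AV j : (1 <= j <= k.+1)%N -> 0 < A j.
  by case/andP => j1 jk; rewrite A0// j1 leqW.
have G0 : 0 < G by apply: gmean_gt0.
have P0 : 0 < P by apply: gmean_gt0.
have Q0 : 0 < Q by apply: gmean_gt0.
have lnG : W k.+2 * ln G = \sum_(1 <= j < k.+2) w j * ln (x j) +
    w k.+2 * ln (x k.+2) by rewrite ln_gmean// big_nat_recr.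
have lnP : W k.+1 * ln P = \sum_(1 <= j < k.+2) w j * ln (A j).
  by rewrite ln_gmean.
have lnQ : W k.+2 * ln Q = W k.+1 * ln P + w k.+2 * ln (A k.+2).
  by rewrite lnP ln_gmean// big_nat_recr.
have lnP2 : W k.+1 * ln P2 = w k.+2 * (ln P - ln (A k.+1)).
  apply: (mulfI (lt0r_neq0 V0)).
  rewrite [RHS]mulrCA mulrBr lnP -abel_psum.
  rewrite ln_prod_powR => [|i _]; last exact: (y0 i.+1 isT (ik i)).
  rewrite !mulr_sumr; apply: eq_bigr => i _.
  rewrite (lny i.+1 isT (ik i)) -[psum w i.+1]/(W i.+1).
  by field; rewrite gt_eqF.
have un0 : 0 < u k.+2 by exact: (u0 k.+2 (leqnn _)).
have yn0 : 0 < y k.+1 by exact: (y0 k.+1 isT (leqnn _)).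
have GQ : W k.+2 * (G / Q) <= W k.+1 * P1 + w k.+2 * u k.+2.
  rewrite WnE addrC.
  apply: (le_weighted_amgm (ltW V0) (ltW wn0) P10 un0 (divr_gt0 G0 Q0)).
  rewrite addrC -WnE (@ln_div _ G Q)// (lnu k.+2 (leqnn _)).
  by rewrite mulrBr lnG lnQ lnP lnP1; ring.
have PQ : W k.+2 * (P / Q) <= W k.+1 * P2 + w k.+2 * y k.+1.
  rewrite WnE addrC.
  apply: (le_weighted_amgm (ltW V0) (ltW wn0) P20 yn0 (divr_gt0 P0 Q0)).
  rewrite addrC -WnE (@ln_div _ P Q)// (lny k.+1 isT (leqnn _)).
  by rewrite mulrBr lnQ lnP2 WnE; ring.
have last_step := step k.+1 isT (leqnn _).
suff : W k.+1 * P + w k.+2 * G <= W k.+2 * Q.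
  have := ameanS (gmean w x) V0 Wn0.
  rewrite -/W -/G /gmean_of_ameans /amean_of_gmeans -/A -/P -/Q !mulrBr => ->.
  lra.
rewrite -ler_pdivrMr// -(ler_pM2l Wn0).
have -> : W k.+2 * ((W k.+1 * P + w k.+2 * G) / Q) =
  W k.+1 * (W k.+2 * (P / Q)) + w k.+2 * (W k.+2 * (G / Q)) by ring.
apply: (@le_trans _ _ (W k.+1 * (w k.+2 * P1 + W k.+1 * P2) +
    w k.+2 * (w k.+2 * u k.+2 + W k.+1 * y k.+1))).
  have := ler_wpM2l (ltW V0) PQ; have := ler_wpM2l (ltW wn0) GQ.
  lra.
rewrite [u _]/u [y _]/y last_step -WnE.
apply: le_trans (lerD (ler_wpM2l (ltW V0) main) (lexx _)) _.
by rewrite -mulrDl (addrC (W _)) -WnE.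
Qed.
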